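(* Let $f:\mathbb{R}^n\to\mathbb{R}$ be differentiable with $L$-Lipschitz continuous gradient for some $L>0$, and suppose $f_{\inf}:=\inf_{x\in\mathbb{R}^n} f(x)>-\infty$. Let $\rho>0$ with $L\rho<1$, let $0<h\le 1/L$, let $x_0\in\mathbb{R}^n$, and let $(x_k)$ be generated by $$y_k=x_k+\rho\,\nabla f(x_k),\qquad x_{k+1}=x_k-h\nabla f(y_k).$$ Put $\Delta_0=f(x_0)-f_{\inf}$. Then for every integer $T\ge 1$, $$\min_{0\le k<T}\|\nabla f(x_k)\|\le\left(\frac{2\Delta_0}{h(1-L^2\rho^2)T}\right)^{1/2},$$ and $\|\nabla f(x_k)\|\to 0$ as $k\to\infty$.
   Context: $\|\cdot\|$ is the Euclidean norm on $\mathbb{R}^n$. (This is the unnormalized case $\alpha=0$ of the $\mathrm{SAM}_\alpha$ iteration; if $\nabla f(x_k)=0$ for some $k$, the iterates stay at $x_k$.) *)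

(* Defs.v *)
From HB Require Import structures.
From mathcomp Require Import all_boot all_order all_algebra.
From mathcomp Require Import all_classical all_reals all_analysis.

Set Implicit Arguments.
Unset Strict Implicit.
Unset Printing Implicit Defensive.

Import Order.TTheory GRing.Theory Num.Theory.
Import numFieldNormedType.Exports.

Local Open Scope ring_scope.
Local Open Scope classical_set_scope.

(** The library norm [`|v|] on ['rV[R]_n] is the sup norm, hence this separate
    definition. Both norms induce the same topology, so that [differentiable]
    has its usual meaning. *)
Definition enorm (R : realType) (n : nat) (v : 'rV[R]_n) : R :=
  Num.sqrt (\sum_(i < n) v 0 i ^+ 2).

(** ['D_v f x] is a total operator: this row of partial derivatives represents
    the differential ['d f x] only where [f] is differentiable. *)
Definition grad (R : realType) (n : nat) (f : 'rV[R]_n -> R) (x : 'rV[R]_n) :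
    'rV[R]_n :=
  \row_(i < n) 'D_(delta_mx 0 i) f x.

(* Main.v *)
Require Import Defs.
From HB Require Import structures.
From mathcomp Require Import all_boot all_order all_algebra.
From mathcomp Require Import all_classical all_reals all_analysis.
From mathcomp Require Import ring lra.
Import Order.TTheory GRing.Theory Num.Theory.
Import numFieldNormedType.Exports.
Local Open Scope ring_scope.
Local Open Scope classical_set_scope.

(** Write [g_k] for the gradient at [x_k] and [g'_k] for the gradient at [y_k].
    A function whose gradient is [L]-Lipschitz lies below a quadratic model of
    curvature [L] around each point ([descent_lemma]); this comes from
    monotonicity of the gap between function and model along a segment.
    For the step [- h g'_k] the model yields, because [h L <= 1],
[[
    f(x_{k+1}) <= f(x_k) - h <g_k, g'_k> + h/2 |g'_k|^2
                = f(x_k) - h/2 |g_k|^2 + h/2 |g_k - g'_k|^2.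
]]
    The perturbed gradient is evaluated at distance [rho |g_k|] from [x_k], so
    that [|g_k - g'_k| <= L rho |g_k|]: the error is a fraction of the gain, and
    each step lowers [f] by at least [h/2 (1 - L^2 rho^2) |g_k|^2]
    ([sam_step_decrease]).

    Since [f] is bounded below, these decreases telescope to a bound
    on the sum of all the [|g_k|^2] that does not depend on the number of steps
    ([sum_sqr_grad_le]). A minimum is at most an average, which is the rate,
    and the terms of a convergent series tend to zero, which is the limit. *)

(** * The Euclidean inner product *)

Definition dot {R : realType} {n : nat} (u v : 'rV[R]_n) : R :=
  \sum_(i < n) u 0 i * v 0 i.

Lemma dotC {R : realType} {n : nat} (u v : 'rV[R]_n) : dot u v = dot v u.
Proof. by apply: eq_bigr => i _; rewrite mulrC. Qed.

Lemma dotBl {R : realType} {n : nat} (u v w : 'rV[R]_n) :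
  dot (u - v) w = dot u w - dot v w.
Proof.
rewrite /dot -sumrB; apply: eq_bigr => i _.
by rewrite !mxE mulrDl mulNr.
Qed.

Lemma dotZl {R : realType} {n : nat} (a : R) (u v : 'rV[R]_n) :
  dot (a *: u) v = a * dot u v.
Proof. by rewrite /dot mulr_sumr; apply: eq_bigr => i _; rewrite mxE mulrA. Qed.

Lemma dotBr {R : realType} {n : nat} (u v w : 'rV[R]_n) :
  dot w (u - v) = dot w u - dot w v.
Proof. by rewrite dotC dotBl !(dotC w). Qed.

Lemma dotZr {R : realType} {n : nat} (a : R) (u v : 'rV[R]_n) :
  dot u (a *: v) = a * dot u v.
Proof. by rewrite dotC dotZl dotC. Qed.

Lemma dot_ge0 {R : realType} {n : nat} (u : 'rV[R]_n) : 0 <= dot u u.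
Proof. by apply: sumr_ge0 => i _; rewrite -expr2 sqr_ge0. Qed.

Lemma sqr_enorm {R : realType} {n : nat} (u : 'rV[R]_n) :
  enorm u ^+ 2 = dot u u.
Proof. by rewrite sqr_sqrtr; [|apply: sumr_ge0 => i _; rewrite sqr_ge0]. Qed.

Lemma enorm_ge0 {R : realType} {n : nat} (u : 'rV[R]_n) : 0 <= enorm u.
Proof. exact: sqrtr_ge0. Qed.

Lemma enormZ {R : realType} {n : nat} (a : R) (u : 'rV[R]_n) :
  enorm (a *: u) = `|a| * enorm u.
Proof.
apply/(pexpIrn (n := 2)) => //; rewrite ?nnegrE ?mulr_ge0 ?enorm_ge0//.
by rewrite sqr_enorm dotZl dotZr exprMn sqr_enorm real_normK ?num_real//; ring.
Qed.

Lemma dot_self_le_of_enorm_le {R : realType} {n : nat} (c : R) (u v : 'rV[R]_n) :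
  0 <= c -> enorm u <= c * enorm v -> dot u u <= c ^+ 2 * dot v v.
Proof.
move=> c0 uv; rewrite -!sqr_enorm -exprMn.
by rewrite ler_pXn2r// nnegrE ?mulr_ge0 ?enorm_ge0.
Qed.

(** This consequence of the Cauchy-Schwarz inequality has a direct proof, by
    expanding the square of the norm of [c v - u]. *)
Lemma dot_le_of_enorm_le {R : realType} {n : nat} (c : R)
    (u v : 'rV[R]_n) :
  0 < c -> enorm u <= c * enorm v -> dot u v <= c * dot v v.
Proof.
move=> c0 /(dot_self_le_of_enorm_le _ _ _ (ltW c0)) uvsq.
have := dot_ge0 (c *: v - u).
rewrite !(dotBl, dotBr, dotZl, dotZr) (dotC v u) => H.
by rewrite -(ler_pM2l c0); lra.
Qed.

(** * The quadratic upper bound *)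

Lemma diff_dot_grad {R : realType} {n : nat} (f : 'rV[R]_n -> R)
    (p v : 'rV[R]_n) :
  differentiable f p -> 'd f p v = dot (grad f p) v.
Proof.
move=> fp; rewrite [in LHS](row_sum_delta v) linear_sum.
by apply: eq_bigr => i _; rewrite linearZ mxE deriveE// mulrC.
Qed.

Lemma is_derive_line {R : realType} {n : nat} (f : 'rV[R]_n -> R)
    (p v : 'rV[R]_n) (t : R) :
  differentiable f (p + t *: v) ->
  is_derive t 1 (fun s : R => f (p + s *: v)) (dot (grad f (p + t *: v)) v).
Proof.
move=> fp.
have dl : is_diff t (fun s : R => p + s *: v) (fun s : R => s *: v).
  have := is_diffD (is_diff_cst p (t : R^o)) (is_diff_scalel t v).
  by rewrite add0r; exact.
have df : is_diff (p + t *: v) f ('d f (p + t *: v)) by exact: DiffDef.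
have /= dc := is_diff_comp dl df.
have dd : differentiable (fun s : R => f (p + s *: v)) t by exact: ex_diff.
apply: DeriveDef; first exact: diff_derivable.
by rewrite deriveE// (diff_val (is_diff_def := dc)) /= scale1r diff_dot_grad.
Qed.

(** Along the segment from [p] to [p + v], the derivative of [f] minus its
    quadratic model is [<grad f (p + t v) - grad f p, v> - t L |v|^2], which the
    Lipschitz condition makes nonpositive; so this gap, which vanishes
    at [t = 0], is nonpositive at [t = 1]. *)
Lemma descent_lemma {R : realType} {n : nat} (f : 'rV[R]_n -> R) (L : R)
    (p v : 'rV[R]_n) :
  0 < L -> (forall u, differentiable f u) ->
  (forall u w, enorm (grad f u - grad f w) <= L * enorm (u - w)) ->
  f (p + v) <= f p + dot (grad f p) v + L / 2 * dot v v.
Proof.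
move=> L0 f_diff lip.
pose phi (t : R) :=
  f (p + t *: v) - t * dot (grad f p) v - t ^+ 2 * (L / 2 * dot v v).
pose dphi (t : R) := dot (grad f (p + t *: v)) v - dot (grad f p) v
   - t * (L * dot v v).
have dphiP (t : R) : is_derive t 1 phi (dphi t).
  have lin := is_derive_line f p v t (f_diff _).
  by apply: is_derive_eq; rewrite /dphi /GRing.scale /=; field.
have phi_dec : phi 1 <= phi 0.
  apply: (@ler0_derive1_nincr R phi 0 1 _ _ _ 0 1) => // [t|].
  - rewrite in_itv /= => /andP[t0 _].
    rewrite derive1E derive_val /dphi -dotBl.
    suff : dot (grad f (p + t *: v) - grad f p) v <= t * L * dot v v by lra.
    apply: dot_le_of_enorm_le; first exact: mulr_gt0.
    apply: le_trans (lip _ _) _.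
    by rewrite addrAC subrr add0r enormZ gtr0_norm// mulrCA mulrA.
  - by apply: derivable_within_continuous => t _; exact: ex_derive.
move: phi_dec.
rewrite /phi scale0r scale1r addr0 expr0n !mul0r expr1n !mul1r !subr0; lra.
Qed.

(** * Decrease along the iteration *)

Lemma sam_step_decrease {R : realType} {n : nat} (f : 'rV[R]_n -> R)
    (L rho h : R) (x : 'rV[R]_n) :
  0 < L -> (forall u, differentiable f u) ->
  (forall u v, enorm (grad f u - grad f v) <= L * enorm (u - v)) ->
  0 <= rho -> 0 < h -> h <= 1 / L ->
  h / 2 * (1 - L ^+ 2 * rho ^+ 2) * enorm (grad f x) ^+ 2
    <= f x - f (x - h *: grad f (x + rho *: grad f x)).
Proof.
move=> L0 f_diff lip rho0 h0; rewrite ler_pdivlMr// => hL.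
set g := grad f x; set g' := grad f (x + rho *: g).
have := descent_lemma f L x (- h *: g') L0 f_diff lip.
rewrite !(dotZl, dotZr) -/g => desc.
have err : dot (g' - g) (g' - g) <= (L * rho) ^+ 2 * dot g g.
  apply: dot_self_le_of_enorm_le; first by rewrite mulr_ge0// ltW.
  apply: le_trans (lip _ _) _.
  by rewrite addrAC subrr add0r enormZ ger0_norm// mulrA.
rewrite !(dotBl, dotBr) (dotC g' g) in err.
(* Since h L <= 1, the second-order term is at most h/2 |g'|^2, and
   - h <g, g'> + h/2 |g'|^2 is h/2 |g - g'|^2 - h/2 |g|^2. *)
have quad : h * L * (h * dot g' g') <= h * dot g' g'.
  by rewrite ler_piMl// mulr_ge0 ?dot_ge0// ltW.
have err_h := ler_wpM2l (ltW h0) err.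
rewrite sqr_enorm -(scaleNr h g'); lra.
Qed.

(** The bound on the right is free of [T], hence serves both for the rate, with
    [T] given, and for the limit, where [T] grows. *)
Lemma sum_sqr_grad_le {R : realType} {n : nat} (f : 'rV[R]_n -> R)
    (L rho h m : R) (x : nat -> 'rV[R]_n) (T : nat) :
  0 < L -> (forall u, differentiable f u) ->
  (forall u v, enorm (grad f u - grad f v) <= L * enorm (u - v)) ->
  0 <= rho -> 0 < h -> h <= 1 / L -> (forall u, m <= f u) ->
  (forall k, x k.+1 = x k - h *: grad f (x k + rho *: grad f (x k))) ->
  h / 2 * (1 - L ^+ 2 * rho ^+ 2) * \sum_(0 <= k < T) enorm (grad f (x k)) ^+ 2
    <= f (x 0%N) - m.
Proof.
move=> L0 f_diff lip rho0 h0 hL mf x_step.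
apply: (@le_trans _ _ (f (x 0%N) - f (x T))); last by rewrite lerD2l lerN2.
rewrite mulr_sumr -[leRHS]opprB -(telescope_sumr (f \o x)) // -sumrN.
apply: ler_sum_nat => k _; rewrite opprB /= x_step.
exact: sam_step_decrease.
Qed.

(** * Infima, minima and limits *)

Lemma ereal_inf_fine_le {R : realType} {T : Type} (f : T -> R) (u : T) :
  (-oo < ereal_inf (range (fun v => (f v)%:E)))%E ->
  fine (ereal_inf (range (fun v => (f v)%:E))) <= f u.
Proof.
have : (ereal_inf (range (fun v => (f v)%:E)) <= (f u)%:E)%E.
  by apply: ereal_inf_lbound; exists u.
by case: (ereal_inf _).
Qed.

Lemma bigmin_le_sqrt_mean {R : realType} (a : nat -> R) (S : R) (T : nat) :
  (0 < T)%N -> (forall k, 0 <= a k) -> \sum_(0 <= k < T) a k ^+ 2 <= S ->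
  \big[Num.min/a 0%N]_(0 <= k < T) a k <= Num.sqrt (S / T%:R).
Proof.
move=> T0 a0 aS; set m := \big[_/_]_(_ <= _ < _) _.
have m0 : 0 <= m by apply: le_bigmin.
have T0' : 0 < T%:R :> R by rewrite ltr0n.
rewrite -(ger0_norm m0) -sqrtr_sqr; apply: ler_wsqrtr.
rewrite ler_pdivlMr// mulr_natr (le_trans _ aS)//.
rewrite -[T in leLHS]subn0 -sumr_const_nat; apply: ler_sum_nat => k kT.
rewrite ler_pXn2r ?nnegrE// /m big_mkord.
by rewrite (bigmin_le_cond _ (j := Ordinal (n := T) (m := k) _)).
Qed.

Lemma cvg0_of_sum_sqr_le {R : realType} (a : nat -> R) (S : R) :
  (forall k, 0 <= a k) ->
  (forall T, \sum_(0 <= k < T) a k ^+ 2 <= S) -> a k @[k --> \oo] --> (0 : R).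
Proof.
move=> a0 aS.
have sq0 : (fun k => a k ^+ 2) @ \oo --> (0 : R).
  apply: cvg_series_cvg_0; apply: nondecreasing_is_cvgn.
    by apply: nondecreasing_series => k _ _; exact: sqr_ge0.
  by exists S => _ [T _ <-]; exact: aS.
rewrite (_ : a = fun k => Num.sqrt (a k ^+ 2)); last first.
  by apply/funext => k; rewrite sqrtr_sqr ger0_norm.
rewrite -[X in _ --> X]sqrtr0.
by apply: continuous_cvg => //; exact: sqrt_continuous.
Qed.

Theorem theorem6 (R : realType) (n : nat) (f : 'rV[R]_n -> R) (L rho h : R)
    (x0 : 'rV[R]_n) (x y : nat -> 'rV[R]_n)
    (L_gt0 : 0 < L)
    (f_diff : forall u, differentiable f u)
    (grad_lip : forall u v,
       enorm (grad f u - grad f v) <= L * enorm (u - v))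
    (f_inf_gt : (-oo < ereal_inf (range (fun u => (f u)%:E)))%E)
    (rho_gt0 : 0 < rho) (Lrho_lt1 : L * rho < 1)
    (h_gt0 : 0 < h) (h_le : h <= 1 / L)
    (x_init : x 0%N = x0)
    (y_def : forall k, y k = x k + rho *: grad f (x k))
    (x_step : forall k, x k.+1 = x k - h *: grad f (y k)) :
  let f_inf : R := fine (ereal_inf (range (fun u => (f u)%:E))) in
  let Delta0 : R := f x0 - f_inf in
  (forall T : nat, (1 <= T)%N ->
     \big[Num.min/enorm (grad f (x 0%N))]_(0 <= k < T) enorm (grad f (x k))
       <= Num.sqrt (2 * Delta0 / (h * (1 - L ^+ 2 * rho ^+ 2) * T%:R)))
  /\ enorm (grad f (x k)) @[k --> \oo] --> (0 : R).
Proof.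
move=> f_inf Delta0.
set c := h / 2 * (1 - L ^+ 2 * rho ^+ 2).
have Lrho_ge0 : 0 <= L * rho by rewrite mulr_ge0 ?ltW.
have gap_gt0 : 0 < 1 - L ^+ 2 * rho ^+ 2.
  by rewrite -exprMn subr_gt0 expr_lt1.
have c_gt0 : 0 < c by rewrite mulr_gt0 ?divr_gt0.
have sum_le T :
    \sum_(0 <= k < T) enorm (grad f (x k)) ^+ 2 <= Delta0 / c.
  rewrite ler_pdivlMr// mulrC /Delta0 -x_init.
  apply: sum_sqr_grad_le => // [|u|k]; first exact: ltW.
    exact: ereal_inf_fine_le.
  by rewrite x_step y_def.
split=> [T T_gt0|]; last first.
  by apply: (cvg0_of_sum_sqr_le _ _ _ sum_le) => k; exact: enorm_ge0.
have -> : 2 * Delta0 / (h * (1 - L ^+ 2 * rho ^+ 2) * T%:R)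
    = Delta0 / c / T%:R.
  rewrite /c; field.
  by rewrite exprMn (lt0r_neq0 h_gt0) (lt0r_neq0 gap_gt0) pnatr_eq0 -lt0n T_gt0.
by apply: bigmin_le_sqrt_mean => // k; exact: enorm_ge0.
Qed.
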